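(* Let $n>2$ and let $\mathcal{I}_{n,q}$ be the set of integers $h$ dividing $n$ and such that $1<h<q$. For any $h\in\mathcal{I}_{n,q}$, let $L_h$ be the linear set in $\mathrm{PG}(1,q^n)$ obtained by projecting a $q$-subplane $\Sigma$ of $\mathrm{PG}(2,q^n)$ from a point $\Theta_h$ collinear with a $q$-subline $b$ in $\Sigma$ (that is, $\Theta_h\in\langle b\rangle_{q^n}$) and such that $[\Theta_h:b]=h$. Then the elements of the set $\Lambda=\{L_h\mid h\in\mathcal{I}_{n,q}\}$ are $\mathbb{F}_q$-clubs in $\mathrm{PG}(1,q^n)$, all belonging to distinct orbits under $\mathrm{PGL}(2,q^n)$ (for distinct $h$).
   Context: A $q$-subplane $\Sigma$ of $\mathrm{PG}(2,q^n)$ is a set of points $\{\langle xu+yv+zw\rangle_{\mathbb{F}_{q^n}}:(x,y,z)\in\mathbb{F}_q^3\setminus\{0\}\}$ with $u,v,w$ linearly independent over $\mathbb{F}_{q^n}$; its lines are $q$-sublines, i.e. sets of $q+1$ points $\{\langle xu+yv\rangle_{\mathbb{F}_{q^n}}:(x,y)\in\mathbb{F}_q^2\setminus\{(0,0)\}\}$ with $u,v$ independent over $\mathbb{F}_{q^n}$. $\langle b\rangle_{q^n}$ is the line of $\mathrm{PG}(2,q^n)$ containing $b$. For $\Theta\in\langle b\rangle_{q^n}$: if $\Theta\in b$ then $[\Theta:b]=1$; otherwise $[\Theta:b]=[\mathbb{F}_q(\zeta):\mathbb{F}_q]$, where $(1,\zeta)$ are homogeneous coordinates of $\Theta$ on $\langle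 b\rangle_{q^n}$ with respect to a reference frame of three points of $b$ (receiving coordinates $(1,0),(0,1),(1,1)$); this does not depend on the frame. The projection is onto an axis $\mathrm{PG}(1,q^n)\subset\mathrm{PG}(2,q^n)$, a line not through the center $\Theta_h$: a point $P\in\Sigma$ is mapped to the intersection of the line $P\Theta_h$ with the axis. An $\mathbb{F}_q$-linear set of rank three in $\mathrm{PG}(1,q^n)$ is a set of points $L=\{\langle u\rangle_{\mathbb{F}_{q^n}}:u\in U\setminus\{0\}\}$ with $U$ a $3$-dimensional $\mathbb{F}_q$-vector subspace of $\mathbb{F}_{q^n}^2$; the weight of a point $\langle v\rangle_{\mathbb{F}_{q^n}}$ is the $\mathbb{F}_q$-dimension of $U\cap\langle v\rangle_{\mathbb{F}_{q^n}}$. An $\mathbb{F}_q$-club in $\mathrm{PG}(1,q^n)$ is an $\mathbb{F}_q$-linear set of rank three having a point of weight two. *)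

(* Defs.v *)
From HB Require Import structures.
From mathcomp Require Import all_boot all_order all_algebra all_field.
From mathcomp Require Import classical_sets.

Set Implicit Arguments.
Unset Strict Implicit.
Unset Printing Implicit Defensive.

Import GRing.Theory.

Local Open Scope ring_scope.
Local Open Scope classical_set_scope.

(* The ground field F_q is a finite field F and F_{q^n} is an extension K of F
   with \dim {:K} = n. A point of PG(m-1, q^n) is a K-subspace P of 'rV[K]_m
   with \dim P = 1. *)

Section Defs.
Variables (F : finFieldType) (K : fieldExtType F).

Definition subline (u v : 'rV[K]_3) : set {vspace 'rV[K]_3} :=
  [set P | exists x y : F,
     (x, y) != (0, 0) /\ P = <[x%:A *: u + y%:A *: v]>%VS].

Definition is_subline (b : set {vspace 'rV[K]_3}) : Prop :=
  exists u v : 'rV[K]_3, free [:: u; v] /\ b = subline u v.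

Definition subplane (u v w : 'rV[K]_3) : set {vspace 'rV[K]_3} :=
  [set P | exists x y z : F,
     (x, y, z) != (0, 0, 0) /\ P = <[x%:A *: u + y%:A *: v + z%:A *: w]>%VS].

Definition is_subplane (S : set {vspace 'rV[K]_3}) : Prop :=
  exists u v w : 'rV[K]_3, free [:: u; v; w] /\ S = subplane u v w.

Definition collinear_with (T : {vspace 'rV[K]_3}) (b : set {vspace 'rV[K]_3}) :
    Prop :=
  exists l : {vspace 'rV[K]_3},
    [/\ \dim l = 2, forall P, b P -> (P <= l)%VS & (T <= l)%VS].

(* [T : b] = h. The vectors u and v represent two points of b, scaled so that
   the unit point <u + v> of the frame is also in b; then T = <u + z v> has
   coordinates (1, z) in this frame. *)
Definition point_degree (T : {vspace 'rV[K]_3}) (b : set {vspace 'rV[K]_3})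
    (h : nat) : Prop :=
  (b T /\ h = 1%N) \/
  (~ b T /\ exists (u v : 'rV[K]_3) (z : K),
     [/\ free [:: u; v],
         [/\ b <[u]>%VS, b <[v]>%VS & b <[u + v]>%VS],
         T = <[u + z *: v]>%VS
       & h = \dim <<1; z>>%VS]).

Definition mx_image (m k : nat) (A : 'M[K]_(m, k)) (P : {vspace 'rV[K]_m}) :
    {vspace 'rV[K]_k} :=
  (linfun (mulmxr A) @: P)%VS.

(* The axis is the row space of a row-free matrix A, whose rows are the frame
   identifying the axis with PG(1, q^n). *)
Definition projection (S : set {vspace 'rV[K]_3}) (T : {vspace 'rV[K]_3})
    (A : 'M[K]_(2, 3)) : set {vspace 'rV[K]_2} :=
  [set P | \dim P = 1%N /\
     exists2 Q, S Q & mx_image A P = ((Q + T) :&: mx_image A fullv)%VS].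

Definition is_projected_set (h : nat) (L : set {vspace 'rV[K]_2}) : Prop :=
  exists (S b : set {vspace 'rV[K]_3}) (T : {vspace 'rV[K]_3})
         (A : 'M[K]_(2, 3)),
    [/\ is_subplane S, is_subline b /\ b `<=` S,
        [/\ \dim T = 1%N, collinear_with T b & point_degree T b h],
        row_free A /\ ~ (T <= mx_image A fullv)%VS
      & L = projection S T A].

(* {ffun 'I_2 -> K} is K^2 as a vector space over F, whereas 'rV[K]_2 is K^2 as
   a vector space over K. *)
Definition row_of (u : {ffun 'I_2 -> K}) : 'rV[K]_2 := \row_i u i.

Definition linear_set (U : {vspace {ffun 'I_2 -> K}}) :
    set {vspace 'rV[K]_2} :=
  [set P | exists2 u, u \in U & u != 0 /\ P = <[row_of u]>%VS].

Definition has_weight (U : {vspace {ffun 'I_2 -> K}}) (P : {vspace 'rV[K]_2})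
    (w : nat) : Prop :=
  exists W : {vspace {ffun 'I_2 -> K}},
    (forall u, (u \in W) = (u \in U) && (row_of u \in P)) /\ \dim W = w.

Definition is_club (L : set {vspace 'rV[K]_2}) : Prop :=
  exists U : {vspace {ffun 'I_2 -> K}},
    [/\ \dim U = 3, L = linear_set U
      & exists2 P, \dim P = 1%N & has_weight U P 2].

(* PGL(2, q^n) acts through its representatives in GL(2, q^n). *)
Definition PGL_orbit (L : set {vspace 'rV[K]_2}) :
    set (set {vspace 'rV[K]_2}) :=
  [set L' | exists2 g : 'M[K]_2, g \in unitmx & L' = mx_image g @` L].

End Defs.

Definition I_nq (n q : nat) : set nat := [set h | (h %| n) && (1 < h < q)]%N.

(* Main.v *)
Require Import Defs.
From HB Require Import structures.
From mathcomp Require Import all_boot all_order all_algebra all_field.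
From mathcomp Require Import fingroup cyclic.
From mathcomp Require Import classical_sets.
From mathcomp Require Import ring.

(** In suitable coordinates all the projected sets have one normal form, and a
cross-ratio argument recovers the degree h from it.

Normal form. Let the center have degree h > 1 over the subline. The three frame
points of the subline lie in the subplane, so their scaling factors agree up to
elements of F, and the center is <e0 + z e1> for a basis e0, e1, e2 of the
F-lattice defining the subplane, with h = [F(z) : F] ([adapted_frame]).
Projecting from the center is taking the quotient by e0 + z e1: the point
<s0 e0 + s1 e1 + s2 e2> goes to <(s1 - s0 z, s2)>. Hence the projected set is,
up to a change D of the frame of the axis, the set of the points
<(s1 - s0 z, s2)> with s in F^3 nonzero ([projected_set_normal_form]).

Clubs. As z is not in F, these vectors form an F-space of dimension 3, in which
the multiples of (1, 0) are those with s2 = 0, a subspace of dimension 2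
([rational_points_club]).

Orbits. All points of the normal form have coordinates in F(z), and the points
(1, 0), (0, 1), (1, 1), (z, 1) with cross-ratio z are among them. Projectivities
preserve cross-ratios, so if a projectivity maps the set with parameter z into
the set with parameter z', then z is a cross-ratio of four points with
coordinates in F(z'), whence z is in F(z') ([cross_ratio_subfield]). So sets in
the same orbit have the same field F(z), and thus the same degree.

Existence. A cyclic extension of degree n has a subfield of each degree h
dividing n, and that subfield is F(z) for some z ([exists_degree]); the center
<e0 + z e1> then gives a projected set. *)

Set Implicit Arguments.
Unset Strict Implicit.
Unset Printing Implicit Defensive.

Import GRing.Theory.

Local Open Scope ring_scope.
Local Open Scope classical_set_scope.

(** * Lines and completion to a basis *)

Lemma vline_eqP (F : fieldType) (V : vectType F) (u v : V) :
  u != 0 -> <[u]>%VS = <[v]>%VS -> exists2 k, k != 0 & u = k *: v.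
Proof.
move=> u0 uv; have /vlineP[k uE] : u \in <[v]>%VS by rewrite -uv memv_line.
exists k => //; apply: contraNneq u0 => k0; by rewrite uE k0 scale0r.
Qed.

Lemma vlineZ (F : fieldType) (V : vectType F) (k : F) (v : V) :
  k != 0 -> <[k *: v]>%VS = <[v]>%VS.
Proof.
move=> k0; apply/eqP; rewrite eqEsubv; apply/andP; split; rewrite -memvE.
  by rewrite memvZ // memv_line.
by apply/vlineP; exists k^-1; rewrite scalerA mulVf // scale1r.
Qed.

(** A full Gaussian decomposition writes A as C [1 0] B with C and B invertible;
replacing C [1 0] by the block diagonal matrix of C and 1 adds the missing
rows. *)
Lemma row_free_completion (F : fieldType) m n (A : 'M[F]_(m, m + n)) :
  row_free A -> exists2 P : 'M_(m + n), P \in unitmx & usubmx P = A.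
Proof.
move=> /eqP rA.
exists (block_mx (col_ebase A) 0 0 1%:M *m row_ebase A).
  rewrite unitmx_mul row_ebase_unit andbT unitmxE det_ublock det1 mulr1.
  by rewrite -unitmxE col_ebase_unit.
rewrite /block_mx mul_col_mx col_mxKu -[X in row_mx X]mulmx1.
rewrite -[X in row_mx _ X](mulmx0 _ (col_ebase A)) -mul_mx_row -pid_mx_row.
by rewrite -[RHS]mulmx_ebase rA.
Qed.

(** * Points with rational coordinates *)

Section RationalPoints.
Variables (F : finFieldType) (K : fieldExtType F).

Local Notation "A ^K" := (map_mx (in_alg K) A) (at level 2, format "A ^K").

(** Subplanes, linear sets and the normal form of clubs are all of this kind: the
rows of G span an F-lattice, and the points are those of its nonzero vectors. *)
Definition rational_points m k (G : 'M[K]_(m, k)) : set {vspace 'rV[K]_k} :=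
  [set P | exists2 s : 'rV[F]_m, s != 0 & P = <[s^K *m G]>%VS].

Lemma rational_points_frame m k (P : 'M[F]_m) (G : 'M[K]_(m, k)) :
  P \in unitmx -> rational_points (P^K *m G) = rational_points G.
Proof.
move=> uP; apply/seteqP; split=> Q /= [s s0 ->].
  exists (s *m P); last by rewrite map_mxM mulmxA.
  by apply: contra_neq s0 => /(canRL (mulmxK uP)) ->; rewrite mul0mx.
exists (s *m invmx P); last by rewrite mulmxA -map_mxM mulmxKV.
by apply: contra_neq s0 => /(canRL (mulmxKV uP)) ->; rewrite mul0mx.
Qed.

Lemma mx_image_line m k (A : 'M[K]_(m, k)) (v : 'rV_m) :
  mx_image A <[v]>%VS = <[v *m A]>%VS.
Proof. by rewrite /mx_image limg_line lfunE. Qed.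

Lemma mx_imageP m k (A : 'M[K]_(m, k)) (P : {vspace 'rV[K]_m}) w :
  reflect (exists2 v, v \in P & w = v *m A) (w \in mx_image A P).
Proof.
apply: (iffP memv_imgP) => -[v vP ->]; exists v => //; by rewrite lfunE.
Qed.

Lemma mx_image_inj m k (A : 'M[K]_(m, k)) :
  row_free A -> injective (mx_image A).
Proof.
move=> A_free; suff sub P Q : mx_image A P = mx_image A Q -> (P <= Q)%VS.
  by move=> P Q PQ; apply/eqP; rewrite eqEsubv !sub.
move=> PQ; apply/subvP => x xP.
have /mx_imageP[z zQ /(row_free_inj A_free) -> //] : x *m A \in mx_image A Q.
by rewrite -PQ; apply/mx_imageP; exists x.
Qed.

Lemma mx_image1 m (P : {vspace 'rV[K]_m}) : mx_image 1%:M P = P.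
Proof.
apply/vspaceP => v; apply/mx_imageP/idP => [[w wP ->]|vP].
  by rewrite mulmx1.
by exists v; rewrite ?mulmx1.
Qed.

Lemma PGL_orbit_refl (L : set {vspace 'rV[K]_2}) : PGL_orbit L L.
Proof.
exists 1%:M; rewrite ?unitmx1 //.
apply/seteqP; split=> P /=; first by exists P; rewrite ?mx_image1.
by case=> Q LQ <-; rewrite mx_image1.
Qed.

Lemma mx_image_rational_points m k l (G : 'M[K]_(m, k)) (g : 'M[K]_(k, l)) :
  mx_image g @` rational_points G = rational_points (G *m g).
Proof.
apply/seteqP; split=> Q /=.
  by case=> P [s s0 ->] <-; exists s => //; rewrite mx_image_line mulmxA.
case=> s s0 ->; exists <[s^K *m G]>%VS; first by exists s.
by rewrite mx_image_line mulmxA.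
Qed.

Lemma free_row_free m k (X : m.-tuple 'rV[K]_k) :
  free X -> row_free (\matrix_i X`_i : 'M_(m, k)).
Proof.
move=> /freeP fX; apply: inj_row_free => v vX; apply/rowP => i.
rewrite mxE; apply: (fX (v 0)); rewrite -[RHS]vX; apply/rowP => j.
by rewrite summxE mxE; apply: eq_bigr => l _; rewrite !mxE.
Qed.

Lemma row3_eq0 (s : 'rV[F]_3) :
  s 0 0 = 0 -> s 0 1 = 0 -> s 0 2%:R = 0 -> s = 0.
Proof.
move=> a b c; apply/rowP => i; rewrite mxE.
case: i => -[|[|[|//]]] i3;
  [rewrite -[RHS]a | rewrite -[RHS]b | rewrite -[RHS]c];
  by apply: (congr1 (s 0)); exact: val_inj.
Qed.

Lemma subplaneE (u v w : 'rV[K]_3) :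
  subplane u v w = rational_points (\matrix_i [:: u; v; w]`_i : 'M_(3, 3)).
Proof.
apply/seteqP; split=> Q /=.
  case=> x [y [z [xyz ->]]]; exists (\row_i [:: x; y; z]`_i).
    apply: contra_neq xyz => /rowP s0.
    have := (s0 0, s0 1, s0 2%:R); rewrite !mxE /= => -[[-> ->] ->] //.
  congr <[_]>%VS; apply/rowP => j; rewrite !mxE !big_ord_recl big_ord0 !mxE /=.
  by rewrite addr0 addrA.
case=> s s0 ->; exists (s 0 0), (s 0 1), (s 0 2%:R); split.
  by apply: contra_neq s0 => -[]; exact: row3_eq0.
congr <[_]>%VS; apply/rowP => j; rewrite !mxE !big_ord_recl big_ord0 !mxE /=.
have -> : lift ord0 ord0 = 1 :> 'I_3 by exact: val_inj.
have -> : lift ord0 (lift ord0 ord0) = 2%:R :> 'I_3 by exact: val_inj.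
by rewrite addr0 addrA.
Qed.

(** * Projection from a point *)

Section Projection.
(* The rows of M are the frame of the subplane, and (1, y) are the coordinates of
   the center t in this frame. The last hypothesis says that the center is not in
   the subplane. *)
Variables (M : 'M[K]_(1 + 2)) (y : 'rV[K]_2) (A : 'M[K]_(2, 1 + 2)).
Hypothesis uM : M \in unitmx.
Local Notation t := (row_mx 1%:M y *m M).
Hypothesis A_free : row_free A.
Hypothesis tA : ~ (<[t]> <= mx_image A fullv)%VS.
Hypothesis y_generic : forall s : 'rV[F]_(1 + 2),
  s^K *m col_mx (- y) 1%:M = 0 -> s = 0.

(** Projecting from t onto the row space of A is the linear map with kernel <t>
that sends the rows of A to the standard basis. It maps the first vector of the
frame to - y times the images of the other two, which form the matrix D. *)
Lemma projection_rational_points :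
  exists2 D : 'M[K]_2, D \in unitmx &
    projection (rational_points M) <[t]>%VS A
    = rational_points (col_mx (- y) 1%:M *m D).
Proof.
(* The center is off the axis, so A and t together form a basis. *)
have uC : (col_mx A t : 'M[K]_(2 + 1)) \in unitmx.
  rewrite -row_free_unit; apply: inj_row_free => v.
  rewrite -[v]hsubmxK mul_row_col => /eqP.
  set a := lsubmx v; set b := rsubmx v; rewrite addr_eq0 => /eqP ab.
  have b0 : b = 0.
    apply/eqP/negP => /negP b0; case: tA.
    rewrite -memvE; apply/mx_imageP.
    have b00 : b 0 0 != 0.
      apply: contra_neq b0 => b00; apply/rowP => i.
      by rewrite !ord1 b00 mxE.
    exists ((- (b 0 0)^-1) *: a); first exact: memvf.
    rewrite -scalemxAl ab scalerN scaleNr opprK {2}[b]mx11_scalar mul_scalar_mx.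
    by rewrite scalerA mulVf ?scale1r.
  move: ab; rewrite b0 mul0mx oppr0 -(mul0mx _ A) => /(row_free_inj A_free) a0.
  by rewrite a0 mul0mx row_mx0.
(* N takes the coordinates along A in this basis. *)
have [N [AN tN NE]] : exists N : 'M_(3, 2), [/\ A *m N = 1%:M, t *m N = 0 &
    forall v : 'rV_3, exists k, v = v *m N *m A + k *: t].
  pose C := invmx (col_mx A t : 'M[K]_(2 + 1)); exists (lsubmx C).
  have : (col_mx A t : 'M[K]_(2 + 1)) *m C = 1%:M by rewrite mulmxV.
  rewrite -{1}[C]hsubmxK mul_col_row scalar_mx_block => /eq_block_mx[-> _ -> _].
  split=> // v; exists ((v *m rsubmx C) 0 0).
  rewrite -[LHS](mulmxKV uC) -/C -{1}[C]hsubmxK mul_mx_row mul_row_col.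
  by rewrite [in X in _ + X *m _](mx11_scalar (v *m _)) mul_scalar_mx.
(* Applying N to t = (1, y) M expresses the first row of M N by the others. *)
have MNE : M *m N = col_mx (- y) 1%:M *m dsubmx (M *m N).
  move: tN; rewrite -mulmxA -{1}[M *m N]vsubmxK mul_row_col mul1mx => /eqP.
  rewrite addr_eq0 => /eqP MNu; rewrite -{1}[M *m N]vsubmxK MNu.
  by rewrite mul_col_mx mulNmx mul1mx.
have uD : dsubmx (M *m N) \in unitmx.
  have : A *m invmx M *m col_mx (- y) 1%:M *m dsubmx (M *m N) = 1%:M.
    by rewrite -mulmxA -MNE mulmxA mulmxKV.
  by case/mulmx1_unit.
exists (dsubmx (M *m N)) => //.
rewrite -MNE; apply/seteqP.
have projE v : mx_image A <[v *m N]>%VS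
    = ((<[v]> + <[t]>) :&: mx_image A fullv)%VS.
  rewrite mx_image_line; have [k vE] := NE v.
  apply/eqP; rewrite eqEsubv -memvE memv_cap; apply/andP; split.
    apply/andP; split; last by apply/mx_imageP; exists (v *m N); rewrite ?memvf.
    rewrite (_ : v *m N *m A = v + - k *: t); last first.
      by rewrite {2}vE scaleNr addrK.
    by rewrite memv_add ?memv_line // memvZ ?memv_line.
  apply/subvP => w; rewrite memv_cap => /andP[/memv_addP[_ /vlineP[a ->]]].
  case=> _ /vlineP[b ->] -> /mx_imageP[x _ wE].
  have := congr1 (mulmx^~ N) wE.
  rewrite /= -mulmxA AN mulmx1 mulmxDl -!scalemxAl tN scaler0 addr0 => xE.
  by rewrite wE -xE -scalemxAl memvZ ?memv_line.
split=> P /=.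
  case=> _ [_ [s s0 ->]]; rewrite -projE -mulmxA.
  by move=> /(mx_image_inj A_free) ->; exists s.
case=> s s0 ->; split.
  rewrite dim_vline MNE mulmxA mulmx_free_eq0 ?row_free_unit //.
  by case: eqP => // /y_generic s00; rewrite s00 eqxx in s0.
by exists <[s^K *m M]>%VS; [exists s | rewrite mulmxA projE].
Qed.
End Projection.

(** * Normal form of the projected sets *)

Lemma row_free_of_factor m k (E : 'M[K]_(m, k)) (X : 'M[K]_m)
    (R : 'M[F]_(m, k)) (G : 'M[K]_k) :
  row_free E -> E = X *m R^K *m G -> row_free R.
Proof.
move=> /eqP rE EE.
rewrite -(row_free_map (in_alg K)) /row_free eqn_leq rank_leq_row.
rewrite -[X in (X <= _)%N]rE EE.
by rewrite (leq_trans (mxrankM_maxl _ _)) // mxrankM_maxr.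
Qed.

(** If u, v and u + v are multiples of lattice vectors r1, r2, r3 by k1, k2, k,
then k1 r1 + k2 r2 = k r3. As r1 and r2 are independent over F, the vector r3 is
their combination with coefficients in F, so k1 / k and k2 / k are in F: a single
factor k brings both u and v into the lattice. *)
Lemma rational_frame (G : 'M[K]_3) (u v : 'rV[K]_3) :
    free [:: u; v] -> rational_points G <[u]>%VS ->
    rational_points G <[v]>%VS -> rational_points G <[u + v]>%VS ->
    G \in unitmx ->
  exists (R : 'M[F]_(1 + 1, 3)) (k : K),
    [/\ row_free R, k != 0 & col_mx u v = k *: (R^K *m G)].
Proof.
move=> fuv [r1 _ uE] [r2 _ vE] [r3 r30 uvE] uG.
have uv_free : row_free (col_mx u v : 'M_(1 + 1, 3)).
  rewrite (_ : col_mx u v = \matrix_i [:: u; v]`_i); last first.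
    apply/matrixP => i j; rewrite !mxE.
    by case: splitP => i' ->; rewrite ord1.
  exact: (free_row_free (X := [tuple u; v])).
have [k1 {}uE] : exists k, u = k *: (r1^K *m G).
  by apply/vlineP; rewrite -uE memv_line.
have [k2 {}vE] : exists k, v = k *: (r2^K *m G).
  by apply/vlineP; rewrite -vE memv_line.
(* As r3 is nonzero, so is u + v, and k can be inverted. *)
have w0 : r3^K *m G != 0 by rewrite mulmx_free_eq0 ?row_free_unit // map_mx_eq0.
have [k' k'0 wE] := vline_eqP w0 (esym uvE).
pose k := k'^-1; have k0 : k != 0 by rewrite invr_eq0.
have {}uvE : u + v = k *: (r3^K *m G) by rewrite wE scalerA mulVf // scale1r.
pose R0 := col_mx r1 r2; pose d := row_mx k1%:M k2%:M : 'rV[K]_(1 + 1).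
have EE : col_mx u v = diag_mx d *m R0^K *m G.
  rewrite uE vE map_col_mx diag_mx_row mul_block_col !mul0mx addr0 add0r.
  have diag1 (a : K) : diag_mx a%:M = a%:M :> 'M_1.
    by apply/matrixP => i j; rewrite !ord1 !mxE.
  by rewrite !diag1 !mul_scalar_mx mul_col_mx -!scalemxAl.
(* Independence of u and v over K forces that of r1 and r2 over F. *)
have R0_free : row_free R0 by exact: row_free_of_factor uv_free EE.
have dE : d *m R0^K = k *: r3^K.
  apply: (can_inj (mulmxK uG)); rewrite -scalemxAl -uvE uE vE map_col_mx.
  by rewrite mul_row_col !mul_scalar_mx mulmxDl -!scalemxAl.
(* A K-combination of F-independent rows that is rational is an F-combination. *)
have /submxP[x r3E] : (r3 <= R0)%MS.
  rewrite -(map_submx (in_alg K)); apply/submxP; exists (k^-1 *: d).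
  by rewrite -scalemxAl dE scalerA mulVf // scale1r.
exists (diag_mx x *m R0), k.
have dx : d = k *: x^K.
  have R0K : row_free R0^K by rewrite row_free_map.
  by apply: (row_free_inj R0K); rewrite dE r3E map_mxM scalemxAl.
have uvE' : col_mx u v = k *: ((diag_mx x *m R0)^K *m G).
  by rewrite EE dx linearZ /= map_mxM map_diag_mx -!scalemxAl.
split=> //; apply: (row_free_of_factor (X := k%:M) uv_free).
by rewrite uvE' mul_scalar_mx scalemxAl.
Qed.

(** The coordinates of the center e0 + z e1 after the first one. *)
Definition center_tail (z : K) : 'rV[K]_2 := \row_i [:: z; 0]`_i.

(** The quotient map of K^3 by e0 + z e1, with e1, e2 as basis of the image. *)
Definition club_mx (z : K) : 'M[K]_(1 + 2, 2) := col_mx (- center_tail z) 1%:M.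

(** The coordinate row (1, z, 0) is split as 1 + 2 for the projection and as 2 + 1
for the completion of the frame; this lemma passes from one to the other. *)
Lemma center_coords n (P : 'M[K]_(2 + 1, n)) z :
  row_mx 1%:M (center_tail z) *m (P : 'M_(1 + 2, n)) =
  (row_mx 1%:M z%:M : 'rV_(1 + 1)) *m usubmx P.
Proof.
have -> : row_mx 1%:M (center_tail z)
    = row_mx (row_mx 1%:M z%:M : 'rV_(1 + 1)) 0 :> 'rV_(2 + 1).
  apply/rowP => i; rewrite !mxE.
  case: splitP => j; case: splitP => l -> /=; rewrite !mxE.
  - by case: splitP => m; rewrite !ord1 ?mxE // => ->.
  - by case: j => -[].
  - case: splitP => m ->; rewrite !ord1 // => -[].
    by case: j => -[] //= ? _; rewrite !mxE.
  - by rewrite !ord1; case: j => -[|[]].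
have := mul_row_col (row_mx 1%:M z%:M : 'rV_(1 + 1)) 0 (usubmx P) (dsubmx P).
by rewrite vsubmxK mul0mx addr0.
Qed.

(** The lattice vectors on the subline given by [rational_frame] are completed to
a basis of the lattice, which describes the same subplane. The hypothesis on h
places the center outside the subline. *)
Lemma adapted_frame S b T h :
    is_subplane S -> b `<=` S -> point_degree T b h -> (1 < h)%N ->
  exists (M : 'M[K]_(1 + 2)) z,
    [/\ M \in unitmx, S = rational_points M,
        T = <[row_mx 1%:M (center_tail z) *m M]>%VS & h = \dim <<1; z>>%VS].
Proof.
move=> [u0 [v0 [w0 [f0 ->]]]] bS [[_ ->] //|[_]].
case=> u [v [z [fuv [bu bv buv] -> ->]]] _.
have := free_row_free (X := [tuple u0; v0; w0]) f0.
move: bS; rewrite subplaneE row_free_unit /=.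
set G := (X in rational_points X) => bS uG.
have [R [k [R_free k0 uvE]]] :=
  rational_frame fuv (bS _ bu) (bS _ bv) (bS _ buv) uG.
have [P uP PR] := @row_free_completion _ 2 1 R R_free.
exists (P^K *m G), z; split => //.
- by rewrite unitmx_mul map_unitmx uP.
- by rewrite rational_points_frame.
rewrite -[RHS](vlineZ _ k0); congr <[_]>%VS.
have -> : u + z *: v = row_mx 1%:M z%:M *m col_mx u v.
  by rewrite mul_row_col mul1mx mul_scalar_mx.
rewrite uvE -PR -scalemxAr !mulmxA; congr (_ *: (_ *m _)).
by rewrite map_usubmx [RHS]center_coords.
Qed.

Lemma club_mxE (s : 'rV[F]_(1 + 2)) z :
  s^K *m club_mx z = \row_i [:: (s 0 1)%:A - (s 0 0)%:A * z; (s 0 2%:R)%:A]`_i.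
Proof.
rewrite -[s^K]hsubmxK mul_row_col mulmx1 mulmxN addrC; apply/rowP => j.
rewrite !mxE big_ord1 !mxE.
have -> : lshift 2 (0 : 'I_1) = 0 :> 'I_3 by exact: val_inj.
case: j => -[|[|//]] j2; rewrite /= ?mulr0 ?subr0.
  by have -> : rshift 1 (Ordinal j2) = 1 :> 'I_3 by exact: val_inj.
by have -> : rshift 1 (Ordinal j2) = 2%:R :> 'I_3 by exact: val_inj.
Qed.

Lemma notin_base (z : K) : (1 < \dim <<1; z>>%VS)%N -> z \notin 1%VS.
Proof. by apply: contraTN => /(Fadjoin_idP (K := 1%AS)) ->; rewrite dimv1. Qed.

Lemma club_mx_eq0 (s : 'rV[F]_(1 + 2)) (z : K) :
  (1 < \dim <<1; z>>%VS)%N -> s^K *m club_mx z = 0 -> s = 0.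
Proof.
move=> /notin_base z1; rewrite club_mxE => /rowP s0.
have := s0 0; have := s0 1; rewrite !mxE /= => /eqP.
rewrite scaler_eq0 oner_eq0 orbF => /eqP s2 /eqP; rewrite subr_eq0 => /eqP s1.
have s00 : s 0 0 = 0.
  apply: contraNeq z1 => s00; rewrite -(mulKf (_ : (s 0 0)%:A != 0) z).
    by rewrite -s1 -(fmorphV (in_alg K)) -(rmorphM (in_alg K)) /= memvZ ?mem1v.
  by rewrite scaler_eq0 oner_eq0 orbF.
apply: row3_eq0 => //; apply/eqP.
by have := s1; rewrite s00 scale0r mul0r => /eqP;
  rewrite scaler_eq0 oner_eq0 orbF.
Qed.

Lemma projected_set_normal_form h L : (1 < h)%N -> is_projected_set h L ->
  exists z (D : 'M[K]_2),
    [/\ D \in unitmx, h = \dim <<1; z>>%VS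
      & L = rational_points (club_mx z *m D)].
Proof.
move=> h1 [S [b [T [A [Ssub [_ bS] [_ _ Tdeg] [A_free TA] ->]]]]].
have [M [z [uM SE TE hE]]] := adapted_frame Ssub bS Tdeg h1.
subst S T.
have y_gen (s : 'rV[F]_(1 + 2)) :
    s^K *m col_mx (- center_tail z) 1%:M = 0 -> s = 0.
  by apply: club_mx_eq0; rewrite -hE.
have [D uD ->] := projection_rational_points uM A_free TA y_gen.
by exists z, D.
Qed.

(** * Cross-ratios and the field of a club *)

(** The determinant of two vectors of K^2, from which cross-ratios are formed. *)
Definition bracket (x y : 'rV[K]_2) : K := x 0 0 * y 0 1 - x 0 1 * y 0 0.

(** The last factor is the determinant of D. *)
Lemma bracketM x y (D : 'M[K]_2) :
  bracket (x *m D) (y *m D) = bracket x y * bracket (row 0 D) (row 1 D).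
Proof.
rewrite /bracket !mxE !big_ord_recl !big_ord0.
have -> : lift ord0 ord0 = 1 :> 'I_2 by exact: val_inj.
ring.
Qed.

Lemma bracketZ a b x y : bracket (a *: x) (b *: y) = a * b * bracket x y.
Proof. rewrite /bracket !mxE; ring. Qed.

Lemma bracket_subfield (E : {subfield K}) (x y : 'rV[K]_2) :
  (forall i, x 0 i \in E) -> (forall i, y 0 i \in E) -> bracket x y \in E.
Proof. by move=> xE yE; rewrite /bracket rpredB ?rpredM. Qed.

(** Write [x, y] for the bracket. The points x1 = (1, 0), x2 = (0, 1),
x3 = (1, 1), x4 = (z, 1) of the first club satisfy
z = [x4, x2] [x3, x1] / ([x4, x1] [x3, x2]), and this quotient is unchanged by
projectivities and rescaling. Hence it can be computed from the corresponding
points of the second club, whose coordinates before E acts are in F(z'). *)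
Lemma cross_ratio_subfield z z' (D E : 'M[K]_2) :
  D \in unitmx ->
  rational_points (club_mx z *m D) `<=` rational_points (club_mx z' *m E) ->
  z \in <<1; z'>>%AS.
Proof.
move=> uD sub.
have image_in (a b c : F)
    (x := \row_i [:: b%:A - a%:A * z; c%:A]`_i : 'rV[K]_2) :
    x != 0 -> exists (k : K) (w : 'rV[K]_2),
    (forall i, w 0 i \in <<1; z'>>%AS) /\ x = k *: (w *m (E *m invmx D)).
  pose s : 'rV[F]_(1 + 2) := \row_i [:: a; b; c]`_i.
  have xE : s^K *m club_mx z = x by rewrite club_mxE !mxE.
  move=> x0; have [|s' _ eqs] := sub <[x *m D]>%VS.
    exists s; last by rewrite mulmxA xE.
    by apply: contra_neq x0 => s0; rewrite -xE s0 map_mx0 mul0mx.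
  have /vlineP[k xD] : x *m D \in <[s'^K *m (club_mx z' *m E)]>%VS.
    by rewrite -eqs memv_line.
  exists k, (s'^K *m club_mx z'); split=> [i|].
    rewrite club_mxE mxE; case: i => -[|[|//]] _ /=.
      by rewrite rpredB ?rpredM ?rpredZ ?rpred1 ?memv_adjoin.
    by rewrite rpredZ ?rpred1.
  by rewrite -[LHS](mulmxK uD) xD -!scalemxAl !mulmxA.
have row0 (a b : K) :
    (a != 0) || (b != 0) -> \row_i [:: a; b]`_i != 0 :> 'rV[K]_2.
  move=> ab; apply: contraTneq ab => /rowP ab0.
  by have := ab0 0; have := ab0 1; rewrite !mxE /= => -> ->; rewrite eqxx.
have [|k1 [w1 [w1E]]] := image_in 0 1 0;
  rewrite /= !(scale0r, scale1r, mul0r, subr0) ?row0 ?oner_eq0 ?orbT // => e1.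
have [|k2 [w2 [w2E]]] := image_in 0 0 1;
  rewrite /= !(scale0r, scale1r, mul0r, subr0) ?row0 ?oner_eq0 ?orbT // => e2.
have [|k3 [w3 [w3E]]] := image_in 0 1 1;
  rewrite /= !(scale0r, scale1r, mul0r, subr0) ?row0 ?oner_eq0 ?orbT // => e3.
have [|k4 [w4 [w4E]]] := image_in (-1) 0 1;
  rewrite /= !(scale0r, scale1r, scaleN1r, mulN1r, opprK, sub0r) ?row0 ?oner_eq0 ?orbT // => e4.
pose c := bracket (row 0 (E *m invmx D)) (row 1 (E *m invmx D)).
have b42 : z = k4 * k2 * (bracket w4 w2 * c).
  by rewrite -bracketM -bracketZ -e4 -e2 /bracket !mxE /=; ring.
have b31 : -1 = k3 * k1 * (bracket w3 w1 * c).
  by rewrite -bracketM -bracketZ -e3 -e1 /bracket !mxE /=; ring.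
have b41 : -1 = k4 * k1 * (bracket w4 w1 * c).
  by rewrite -bracketM -bracketZ -e4 -e1 /bracket !mxE /=; ring.
have b32 : 1 = k3 * k2 * (bracket w3 w2 * c).
  by rewrite -bracketM -bracketZ -e3 -e2 /bracket !mxE /=; ring.
(* Numerator and denominator of the cross-ratio pick up the same factor N. *)
pose N := k1 * k2 * k3 * k4 * c ^+ 2.
have zN : - z = N * (bracket w4 w2 * bracket w3 w1).
  by rewrite -mulrN1 {1}b42 {1}b31 /N; ring.
have N1 : -1 = N * (bracket w4 w1 * bracket w3 w2).
  by rewrite -[LHS]mulr1 {1}b41 {1}b32 /N; ring.
have [N0 q0] : N != 0 /\ bracket w4 w1 * bracket w3 w2 != 0.
  by apply/andP; rewrite -negb_or -mulf_eq0 -N1 oppr_eq0 oner_eq0.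
have -> : z = (bracket w4 w2 * bracket w3 w1) / (bracket w4 w1 * bracket w3 w2).
  apply: (mulIf q0); rewrite divfK //; apply: (mulfI N0).
  by rewrite -zN mulrCA -N1 mulrN1.
by rewrite rpred_div ?rpredM ?bracket_subfield.
Qed.

(** * The normal form is a club *)

Definition coord_fun m (G : 'M[K]_(m, 2)) (s : 'rV[F]_m) : {ffun 'I_2 -> K} :=
  [ffun i => (s^K *m G) 0 i].

Lemma row_of_coord_fun m (G : 'M[K]_(m, 2)) s :
  row_of (coord_fun G s) = s^K *m G.
Proof. by apply/rowP => i; rewrite mxE ffunE. Qed.

Lemma coord_fun_linear m (G : 'M[K]_(m, 2)) : linear (coord_fun G).
Proof.
move=> a s t; apply/ffunP => i.
rewrite !ffunE map_mxD map_mxZ mulmxDl -scalemxAl !mxE.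
by rewrite mulr_algl.
Qed.

HB.instance Definition _ m (G : 'M[K]_(m, 2)) :=
  GRing.isLinear.Build F 'rV[F]_m {ffun 'I_2 -> K} *:%R (coord_fun G)
    (@coord_fun_linear m G).

Definition rational_span m (G : 'M[K]_(m, 2)) : {vspace {ffun 'I_2 -> K}} :=
  limg (linfun (coord_fun G)).

Lemma row_of_inj : injective (@row_of F K).
Proof. by move=> u v /rowP uv; apply/ffunP => i; have := uv i; rewrite !mxE. Qed.

Lemma rational_spanP m (G : 'M[K]_(m, 2)) u :
  reflect (exists s : 'rV[F]_m, row_of u = s^K *m G) (u \in rational_span G).
Proof.
apply: (iffP memv_imgP) => [[s _ ->] | [s us]]; exists s.
- by rewrite lfunE /= row_of_coord_fun.
- exact: memvf.
- by apply: row_of_inj; rewrite lfunE /= row_of_coord_fun.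
Qed.

Lemma dim_rational_span m (G : 'M[K]_(m, 2)) :
  (forall s : 'rV[F]_m, s^K *m G = 0 -> s = 0) -> \dim (rational_span G) = m.
Proof.
move=> inj; rewrite limg_dim_eq ?dimvf ?/dim /= ?mul1n //.
apply/eqP; rewrite capfv -subv0; apply/subvP => s; rewrite memv_ker lfunE memv0.
move=> /eqP s0; apply/eqP/inj; rewrite -row_of_coord_fun s0.
by apply/rowP => i; rewrite !mxE ffunE.
Qed.

(** The point of weight two is <(1, 0) D>: a vector (s1 - s0 z, s2) lies on
<(1, 0)> exactly when s2 = 0, which leaves s0 and s1 free. *)
Lemma rational_points_club z (D : 'M[K]_2) :
  (1 < \dim <<1; z>>%VS)%N -> D \in unitmx ->
  is_club (rational_points (club_mx z *m D)).
Proof.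
move=> z1 uD; set G := club_mx z *m D.
have G_inj (s : 'rV[F]_(1 + 2)) : s^K *m G = 0 -> s = 0.
  rewrite /G mulmxA => /eqP; rewrite mulmx_free_eq0 ?row_free_unit // => /eqP.
  exact: club_mx_eq0.
exists (rational_span G); split.
- by rewrite dim_rational_span.
- apply/seteqP; split=> P /=.
    case=> s s0 ->; exists (coord_fun G s).
      by apply/rational_spanP; exists s; rewrite row_of_coord_fun.
    rewrite row_of_coord_fun; split=> //; apply: contra_neq s0 => s0.
    apply: G_inj; rewrite -row_of_coord_fun s0.
    by apply/rowP => i; rewrite !mxE ffunE.
  case=> u /rational_spanP[s us] [u0 ->]; exists s; last by rewrite us.
  apply: contra_neq u0 => s0; apply: row_of_inj; rewrite us s0 map_mx0 mul0mx.
  by apply/rowP => i; rewrite !mxE ffunE.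
(* J embeds F^2 into F^3 as the plane s2 = 0. *)
pose J : 'M[F]_(2, 1 + 2) := \matrix_(i, j) (i == j :> nat)%:R.
have JE (s : 'rV[F]_2) : s *m J = \row_i [:: s 0 0; s 0 1; 0]`_i.
  apply/rowP => j; rewrite !mxE !big_ord_recl big_ord0 !mxE /=.
  have -> : lift ord0 ord0 = 1 :> 'I_2 by exact: val_inj.
  by case: j => -[|[|[|//]]] j3; rewrite /= !(mulr0, mulr1, addr0, add0r).
pose e : 'rV[K]_2 := \row_i [:: 1; 0]`_i.
exists <[e *m D]>%VS.
  rewrite dim_vline mulmx_free_eq0 ?row_free_unit // (_ : e != 0) //.
  by apply/eqP => /rowP/(_ 0); rewrite !mxE /=; apply/eqP/oner_neq0.
exists (rational_span (J^K *m G)); split; last first.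
  apply: dim_rational_span => s; rewrite mulmxA -map_mxM => /G_inj.
  rewrite JE => /rowP s0; apply/rowP => i; rewrite mxE.
  case: i => -[|[|//]] i2; [have := s0 0 | have := s0 1];
    rewrite !mxE /= => s00;
    by rewrite -[RHS]s00; apply: (congr1 (s 0)); exact: val_inj.
move=> u; apply/rational_spanP/andP.
  case=> s us; split.
    by apply/rational_spanP; exists (s *m J); rewrite us mulmxA -map_mxM.
  rewrite us mulmxA -map_mxM JE /G mulmxA club_mxE.
  apply/vlineP; exists ((s 0 1)%:A - (s 0 0)%:A * z); rewrite scalemxAl.
  congr (_ *m D); apply/rowP => i; rewrite !mxE.
  by case: i => -[|[|//]] i2 /=; rewrite ?mulr1 ?mulr0 ?scale0r.
case=> /rational_spanP[s us] /vlineP[k]; rewrite us /G mulmxA scalemxAl.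
move=> /(can_inj (mulmxK uD)); rewrite club_mxE => /rowP/(_ 1).
rewrite !mxE /= mulr0 => /eqP; rewrite scaler_eq0 oner_eq0 orbF => /eqP s2.
exists (\row_i [:: s 0 0; s 0 1]`_i).
by rewrite [RHS]mulmxA -map_mxM JE [RHS]mulmxA club_mxE !mxE /= s2.
Qed.

(** * Existence of projected sets *)

(** The Galois group of K over F is cyclic of order n = [K : F]. The fixed field
of the h-th power of a generator is the base of an extension K of degree n / h,
so it has degree h over F; being separable, it is generated by one element. *)
Lemma exists_degree h :
  (0 < h)%N -> (h %| \dim {:K})%N -> exists z : K, h = \dim <<1; z>>%VS.
Proof.
move=> h0 hdvd; pose L : splittingFieldType F := finvect_type K.
have [a /= aG _] := @finField_galois_generator F L 1%AS {:L}%AS (sub1v _).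
have oa : #[a]%g = \dim {:K}.
  rewrite orderE -(eqP aG) -(galois_dim (finField_galois (sub1v _))).
  by rewrite dimv1 divn1.
pose G := <[a ^+ h]>%g; pose E := fixedField G.
have dE : \dim E = h.
  have := dim_fixedField G; rewrite -/E.
  rewrite /G -orderE orderXdiv ?oa // => nh.
  have Edvd := field_dimS (subvf E).
  have nh0 : (0 < \dim {:K} %/ h)%N by rewrite divn_gt0 // dvdn_leq // adim_gt0.
  by apply/eqP; rewrite -(eqn_pmul2l nh0) divnK // nh divnK.
have EE : E = <<1; separable_generator 1 E>>%VS.
  apply: eq_adjoin_separable_generator; rewrite ?sub1v //.
  by have /and3P[] := finField_galois (sub1v E).
by exists (separable_generator 1 E); rewrite -[LHS]dE {1}EE.
Qed.

(** The standard subplane is projected from <e0 + z e1> onto the line through e1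
and e2. This center is not in the subline of e0 and e1, since z is not in F. *)
Lemma projected_set_exists h : (1 < h)%N -> (h %| \dim {:K})%N ->
  exists L : set {vspace 'rV[K]_2}, is_projected_set h L.
Proof.
move=> h1 hn; have [z hz] := exists_degree (ltnW h1) hn.
pose r3 (a b c : K) : 'rV[K]_3 := \row_i [:: a; b; c]`_i.
pose u := r3 1 0 0; pose v := r3 0 1 0; pose w := r3 0 0 1.
have combE a b c : a *: u + b *: v + c *: w = r3 a b c.
  apply/rowP => -[[|[|[|//]]] i3];
    by rewrite !mxE /= !(mulr1, mulr0, addr0, add0r).
have comb2E a b : a *: u + b *: v = r3 a b 0 by rewrite -combE scale0r addr0.
have r3_eq a b c a' b' c' :
    r3 a b c = r3 a' b' c' -> [/\ a = a', b = b' & c = c'].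
  move=> /rowP E.
  by have := (E 0, E 1, E 2%:R); rewrite !mxE /= => -[[-> ->] ->].
have r30 : 0 = r3 0 0 0 by rewrite -combE !scale0r !addr0.
have fuvw : free [:: u; v; w].
  apply/(freeP (X := [tuple u; v; w])) => k.
  rewrite !big_ord_recl big_ord0 /= addr0 addrA combE r30 => /r3_eq[k0 k1 k2].
  case=> -[|[|[|//]]] i3;
    [rewrite -[RHS]k0 | rewrite -[RHS]k1 | rewrite -[RHS]k2];
    by congr (k _); exact: val_inj.
have fuv : free [:: u; v].
  by move: fuvw; rewrite -[[:: u; v; w]]/([:: u; v] ++ [:: w]) => /catl_free.
have z1 : z \notin 1%VS by apply: notin_base; rewrite -hz.
pose T := <[u + z *: v]>%VS; pose t := r3 1 z 0.
have TE : T = <[t]>%VS by rewrite /t -comb2E scale1r.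
pose A : 'M[K]_(2, 1 + 2) := row_mx 0 1%:M.
have mulA (x : 'rV[K]_2) : x *m A = row_mx 0 x :> 'rV_(1 + 2).
  by rewrite mul_mx_row mulmx0 mulmx1.
exists (projection (subplane u v w) T A), (subplane u v w), (subline u v), T, A.
split=> //.
- by exists u, v, w.
- split; first by exists u, v.
  move=> P [x [y [xy0 ->]]]; exists x, y, 0.
  split; last by rewrite !scale0r addr0.
  by apply: contra_neq xy0 => -[-> ->].
- split.
  + rewrite TE dim_vline (_ : t != 0) // /t r30; apply/eqP => /r3_eq[/eqP].
    by rewrite oner_eq0.
  + exists <<[:: u; v]>>%VS; split.
    * by move: fuv; rewrite /free => /eqP.
    * move=> P [x [y [_ ->]]]; rewrite -memvE.
      by rewrite memvD // memvZ // memv_span // !inE eqxx ?orbT.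
    * by rewrite -memvE memvD // ?memvZ // memv_span // !inE eqxx ?orbT.
  + right; split.
      case=> x [y [xy0]]; rewrite TE comb2E => xyE.
      have /vlineP[k] : r3 x%:A y%:A 0 \in <[t]>%VS by rewrite xyE memv_line.
      rewrite /t -!comb2E scalerDr !scalerA mulr1 comb2E [in RHS]comb2E.
      move=> /r3_eq[xk yk _].
      case/negP: z1.
      have x0 : x != 0.
        apply: contra_neq xy0 => x0; move: xk yk; rewrite x0 scale0r => <-.
        by rewrite mul0r => /eqP; rewrite scaler_eq0 oner_eq0 orbF => /eqP ->.
      have -> : z = (x^-1 * y) *: 1.
        by rewrite -scalerA yk -xk -scalerAl mul1r scalerA mulVf // scale1r.
      by rewrite memvZ // mem1v.
    exists u, v, z; split=> //.
    split.
    * exists 1, 0; rewrite !scale1r !scale0r addr0; split=> //.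
      apply/eqP => -[/eqP].
      by rewrite oner_eq0.
    * exists 0, 1; rewrite !scale1r !scale0r add0r; split=> //.
      apply/eqP => -[/eqP].
      by rewrite oner_eq0.
    * exists 1, 1; rewrite !scale1r; split=> //; apply/eqP => -[/eqP].
      by rewrite oner_eq0.
- split.
    apply: inj_row_free => x; rewrite [x *m _]mulA.
    move=> /(congr1 (@rsubmx K 1 1 2)).
    by rewrite row_mxKr linear0.
  rewrite TE -memvE => /mx_imageP[x _ /rowP/(_ 0)].
  rewrite [x *m _]mulA => tx; have := row_mxEl (0 : 'M_1) x 0 (0 : 'I_1).
  rewrite (_ : lshift 2 (0 : 'I_1) = 0 :> 'I_3); last exact: val_inj.
  by rewrite -tx !mxE /= => /eqP; rewrite oner_eq0.
Qed.
End RationalPoints.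

Theorem theorem5p4 (F : finFieldType) (K : fieldExtType F) (q n : nat)
    (hq : #|F| = q) (hK : \dim {:K} = n) (hn : (2 < n)%N) :
  (forall h, I_nq n q h ->
     exists L : set {vspace 'rV[K]_2}, is_projected_set h L) /\
  (forall L : nat -> set {vspace 'rV[K]_2},
     (forall h, I_nq n q h -> is_projected_set h (L h)) ->
     (forall h, I_nq n q h -> is_club (L h)) /\
     (forall h h', I_nq n q h -> I_nq n q h' -> h <> h' ->
        PGL_orbit (L h) <> PGL_orbit (L h'))).
Proof.
split=> [h /= /andP[hn' /andP[h1 _]]|L HL].
  by apply: projected_set_exists; rewrite ?hK.
have nf h : I_nq n q h -> exists z (D : 'M[K]_2),
    [/\ D \in unitmx, h = \dim <<1; z>>%VS
      & L h = rational_points (club_mx z *m D)].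
  move=> hI; apply: projected_set_normal_form (HL h hI).
  by case/andP: hI => _ /andP[].
split=> [h hI | h h' hI hI' hh' orb].
  have [z [D [uD hz ->]]] := nf h hI; apply: rational_points_club => //.
  by rewrite -hz; case/andP: hI => _ /andP[].
(* Equality of the orbits gives a projectivity in each direction. *)
have degree_le h1 h2 : I_nq n q h1 -> I_nq n q h2 ->
    PGL_orbit (L h2) (L h1) -> (h1 <= h2)%N.
  move=> /nf[z1 [D1 [uD1 -> L1]]] /nf[z2 [D2 [uD2 -> L2]]] [g _].
  rewrite L1 L2 mx_image_rational_points -mulmxA => L12.
  apply: dimvS; apply/FadjoinP; split; first exact: sub1v.
  apply: (cross_ratio_subfield uD1); rewrite L12; exact: subset_refl.
case: hh'; apply/eqP; rewrite eqn_leq !degree_le //.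
  by rewrite orb; exact: PGL_orbit_refl.
by rewrite -orb; exact: PGL_orbit_refl.
Qed.
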